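(* For every integer $k\geq 42$ there is a constant $t_k$, depending only on $k$, with $$t_k=\frac{\sqrt{2}}{1-2\sin(\pi/8)}+O(k^{-1})\;(\approx 6.03+O(k^{-1}))\quad\text{as } k\to\infty,$$ such that for every finite point set $\mathcal{P}\subset\mathbb{R}^2$ the Yao-Yao graph $\mathsf{YY}_{2k}(\mathcal{P})$ is a geometric $t_k$-spanner.
   Context: Polar angles are measured from the positive $x$-axis, modulo $2\pi$. For a point $u$ and angles $\gamma_1<\gamma_2$, the cone $C_u(\gamma_1,\gamma_2)$ is the set of points $w\neq u$ such that the polar angle of the vector $\overrightarrow{uw}$ lies in $[\gamma_1,\gamma_2)$. Let $\mathcal{P}$ be a finite set of points in the plane and $m$ a positive integer. Yao graph $\mathsf{Y}_m(\mathcal{P})$: for each $u\in\mathcal{P}$ and each $j=0,\dots,m-1$, among the points $v\in\mathcal{P}\cap C_u(2j\pi/m,2(j+1)\pi/m)$ (if any) select one with $|uv|$ smallest and add the directed edge $\overrightarrow{uv}$. Ties are broken in an arbitrary but consistent manner. Yao-Yao graph $\mathsf{YY}_m(\mathcal{P})$: for each $u\in\mathcal{P}$ and each $j=0,\dots,m-1$, among the points $v\in\mathcal{P}\cap C_u(2j\pi/m,2(j+1)\pi/m)$ such that $\overrightarrow{vu}$ is an edge of $\mathsf{Y}_m(\mathcal{P})$ (if any), select one with $|uv|$ smallest and add the edge $\overrightarrow{vu}$ to $\mathsf{YY}_m(\mathcal{P})$. A graph $G$ with vertex set $\mathcal{P}$ (edges regarded as undirected, with Euclidean lengths) is a geometric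 $t$-spanner if for all $u,v\in\mathcal{P}$ the shortest $u$-$v$ path in $G$ has length at most $t|uv|$. *)

(* Defs.v *)
From Stdlib Require Import Reals List.
Import ListNotations.
Open Scope R_scope.

Definition pt := (R * R)%type.

Definition dist (p q : pt) : R :=
  sqrt ((fst q - fst p) ^ 2 + (snd q - snd p) ^ 2).

(* Cone C_u(g1,g2): points w <> u whose polar angle of vector uw (mod 2pi)
   lies in [g1, g2). Used only with 0 <= g1 < g2 <= 2 PI. *)
Definition in_cone (u : pt) (g1 g2 : R) (w : pt) : Prop :=
  w <> u /\
  exists r th, 0 < r /\ g1 <= th < g2 /\
    fst w = fst u + r * cos th /\ snd w = snd u + r * sin th.

Definition cone (m j : nat) (u w : pt) : Prop :=
  in_cone u (2 * INR j * PI / INR m) (2 * INR (S j) * PI / INR m) w.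

(* A valid Yao selection for P and m: for each u in P and each cone j < m,
   Ysel u j = Some v picks a nearest point of P in the cone (ties broken
   arbitrarily by the choice function), and None iff the cone is empty. *)
Definition yao_selection (P : list pt) (m : nat) (Ysel : pt -> nat -> option pt)
  : Prop :=
  forall u j, In u P -> (j < m)%nat ->
    (Ysel u j = None <-> ~ (exists v, In v P /\ cone m j u v)) /\
    (forall v, Ysel u j = Some v ->
       In v P /\ cone m j u v /\
       forall w, In w P -> cone m j u w -> dist u v <= dist u w).

Definition yao_edge (P : list pt) (m : nat) (Ysel : pt -> nat -> option pt)
  (u v : pt) : Prop :=
  In u P /\ exists j, (j < m)%nat /\ Ysel u j = Some v.

Definition yaoyao_selection (P : list pt) (m : nat)
  (Ysel YYsel : pt -> nat -> option pt) : Prop :=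
  forall u j, In u P -> (j < m)%nat ->
    (YYsel u j = None <->
       ~ (exists v, In v P /\ cone m j u v /\ yao_edge P m Ysel v u)) /\
    (forall v, YYsel u j = Some v ->
       In v P /\ cone m j u v /\ yao_edge P m Ysel v u /\
       forall w, In w P -> cone m j u w -> yao_edge P m Ysel w u ->
         dist u v <= dist u w).

Definition yaoyao_edge (P : list pt) (m : nat) (Ysel YYsel : pt -> nat -> option pt)
  (v u : pt) : Prop :=
  In u P /\ exists j, (j < m)%nat /\ YYsel u j = Some v.

Fixpoint walk (E : pt -> pt -> Prop) (u : pt) (l : list pt) (v : pt) : Prop :=
  match l with
  | [] => u = v
  | x :: l' => (E u x \/ E x u) /\ walk E x l' v
  end.

Fixpoint walk_length (u : pt) (l : list pt) : R :=
  match l with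
  | [] => 0
  | x :: l' => dist u x + walk_length x l'
  end.

(* G (on vertex set P) is a geometric t-spanner: for all u v in P the shortest
   u-v path has length <= t |uv|, i.e. some u-v path has length <= t |uv|. *)
Definition is_spanner (P : list pt) (E : pt -> pt -> Prop) (t : R) : Prop :=
  forall u v, In u P -> In v P ->
    exists l, walk E u l v /\ walk_length u l <= t * dist u v.

Definition t_limit : R := sqrt 2 / (1 - 2 * sin (PI / 8)).

(* Main.v *)
(** Let theta = PI / k.  Given u and z, take about k/2 consecutive cones of u centred at
    the cone of z (a right angle, up to theta) and let v be the point of P nearest to u
    in their union.  Then |vz| <= |uz| - (1 - 2 sin(PI/8) - O(theta)) |uv|, so by
    induction on |uz| it suffices that u and v are joined by a path of length
    (1 + O(theta)) |uv|.

    For the latter, put the horizontal axis along a boundary ray of the right angle, so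
    that v lies below u.  Let x be the Yao-Yao choice at v in the cone of u.  By
    emptiness x is close to u or not below u.  In the second case the height of x over u
    is at most theta |vx|, since the edge vx and the segment vu lie in one cone, and this
    height is the only excess to be paid, at the bad rate t, against the new edge vx.
    From x one descends to u through points not below u, each nearest to the previous
    one in its lower quadrant; such steps are of the same kind with left and right
    exchanged, because the number of cones is even and so the horizontal line is a union
    of cone boundaries on both sides.

    The constant obtained tends to 1 / (1 - 2 sin(PI/8)), without the factor sqrt 2;
    t_limit leaves enough slack to be used itself for all large k. *)

From Stdlib Require Import Reals List Lra Psatz Lia ZArith Zfloor Classical.
Require Import Defs.
Import ListNotations.
Open Scope R_scope.

(** * Bounded-length connections *)

Definition linked (E : pt -> pt -> Prop) (p q : pt) (d : R) : Prop :=
  exists l, walk E p l q /\ walk_length p l <= d.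

Lemma dist_sym p q : dist p q = dist q p.
Proof. unfold dist; f_equal; ring. Qed.

Lemma dist_nonneg p q : 0 <= dist p q.
Proof. apply sqrt_pos. Qed.

Lemma dist_sqr p q :
  dist p q ^ 2 = (fst q - fst p) ^ 2 + (snd q - snd p) ^ 2.
Proof.
  unfold dist; rewrite pow2_sqrt; [reflexivity|].
  apply Rplus_le_le_0_compat; apply pow2_ge_0.
Qed.

Lemma dist_pos p q : p <> q -> 0 < dist p q.
Proof.
  intros Hpq.
  destruct (dist_nonneg p q) as [H|H]; [exact H|exfalso; apply Hpq].
  pose proof (dist_sqr p q) as Hd; rewrite <- H in Hd.
  destruct p as [a b], q as [c d]; cbn [fst snd] in Hd.
  pose proof (pow2_ge_0 (c - a)); pose proof (pow2_ge_0 (d - b)).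
  assert (c - a = 0) by (apply Rsqr_0_uniq; unfold Rsqr; lra).
  assert (d - b = 0) by (apply Rsqr_0_uniq; unfold Rsqr; lra).
  f_equal; lra.
Qed.

Lemma dist_refl p : dist p p = 0.
Proof. unfold dist; rewrite <- sqrt_0; f_equal; ring. Qed.

Lemma le_of_sqr_le a b : 0 <= b -> a ^ 2 <= b ^ 2 -> a <= b.
Proof. intros; nra. Qed.

Lemma lt_of_sqr_lt a b : 0 <= b -> a ^ 2 < b ^ 2 -> a < b.
Proof. intros; nra. Qed.

Lemma sqr_le a b : 0 <= a -> a <= b -> a ^ 2 <= b ^ 2.
Proof. intros; nra. Qed.

Lemma linked_refl E p : linked E p p 0.
Proof. exists []; simpl; split; [reflexivity|lra]. Qed.

Lemma linked_le E p q d d' : linked E p q d -> d <= d' -> linked E p q d'.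
Proof. intros [l [Hw Hl]] H; exists l; split; [exact Hw|lra]. Qed.

Lemma linked_trans E p q r d d' :
  linked E p q d -> linked E q r d' -> linked E p r (d + d').
Proof.
  intros [l [Hw Hl]] [l' [Hw' Hl']]; exists (l ++ l').
  revert p d Hw Hl; induction l as [|x l IH]; simpl; intros p d Hw Hl.
  - subst q; split; [exact Hw'|lra].
  - destruct Hw as [He Hw].
    destruct (IH x (d - dist p x) Hw ltac:(lra)) as [H1 H2].
    split; [split; assumption|lra].
Qed.

Lemma linked_edge E p q : E p q \/ E q p -> linked E p q (dist p q).
Proof. intros H; exists [q]; simpl; split; [tauto|lra]. Qed.

Lemma linked_sym E p q d : linked E p q d -> linked E q p d.
Proof.
  intros [l [Hw Hl]]; revert p d Hw Hl.
  induction l as [|x l IH]; simpl; intros p d Hw Hl.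
  - subst q; apply linked_le with 0; [apply linked_refl|lra].
  - destruct Hw as [He Hw].
    apply linked_le with ((d - dist p x) + dist x p); [|rewrite (dist_sym x p); lra].
    apply linked_trans with x; [apply IH; [exact Hw|lra]|].
    apply linked_edge; tauto.
Qed.

(** * Minimal elements in finite lists *)

Lemma exists_minimal {A : Type} (lt : A -> A -> Prop) (l : list A) (N : A -> Prop) :
  (forall a, ~ lt a a) -> (forall a b c, lt a b -> lt b c -> lt a c) ->
  (exists a, In a l /\ N a) ->
  exists a, In a l /\ N a /\ forall b, In b l -> N b -> ~ lt b a.
Proof.
  intros Hirr Htr; induction l as [|x l IH]; intros [a [Ha HN]]; [destruct Ha|].
  destruct (classic (exists b, In b l /\ N b)) as [Hl|Hl].
  - destruct (IH Hl) as [b [Hb [HNb Hmin]]].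
    destruct (classic (N x /\ lt x b)) as [[HNx Hxb]|Hx].
    + exists x; split; [left; reflexivity|split; [exact HNx|]].
      intros c [->|Hc] HNc Hcx; [exact (Hirr _ Hcx)|].
      exact (Hmin c Hc HNc (Htr _ _ _ Hcx Hxb)).
    + exists b; split; [right; exact Hb|split; [exact HNb|]].
      intros c [->|Hc] HNc Hcb; [tauto|exact (Hmin c Hc HNc Hcb)].
  - destruct Ha as [->|Ha]; [|exfalso; apply Hl; exists a; tauto].
    exists a; split; [left; reflexivity|split; [exact HN|]].
    intros b [->|Hb] HNb; [apply Hirr|].
    exfalso; apply Hl; exists b; tauto.
Qed.

Lemma finite_induction {A : Type} (lt : A -> A -> Prop) (l : list A) (Q : A -> Prop) :
  (forall a, ~ lt a a) -> (forall a b c, lt a b -> lt b c -> lt a c) ->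
  (forall a, In a l -> (forall b, In b l -> lt b a -> Q b) -> Q a) ->
  forall a, In a l -> Q a.
Proof.
  intros Hirr Htr Hstep a Ha; apply NNPP; intros HQ.
  destruct (exists_minimal lt l (fun a => ~ Q a) Hirr Htr) as [b [Hb [HNb Hmin]]].
  { exists a; tauto. }
  apply HNb, Hstep; [exact Hb|].
  intros c Hc Hcb; apply NNPP; intros HNc; exact (Hmin c Hc HNc Hcb).
Qed.

Lemma exists_nearest (P : list pt) (s : pt) (N : pt -> Prop) :
  (exists a, In a P /\ N a) ->
  exists a, In a P /\ N a /\ forall b, In b P -> N b -> dist s a <= dist s b.
Proof.
  intros H.
  destruct (exists_minimal (fun a b => dist s a < dist s b) P N) as [a [Ha [HN Hm]]];
    [intros; lra|intros; lra|exact H|].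
  exists a; split; [exact Ha|split; [exact HN|]].
  intros b Hb HNb; specialize (Hm b Hb HNb); lra.
Qed.

Lemma distance_induction (P : list pt) (Q : pt -> pt -> Prop) :
  (forall p q, In p P -> In q P ->
     (forall p' q', In p' P -> In q' P -> dist p' q' < dist p q -> Q p' q') ->
     Q p q) ->
  forall p q, In p P -> In q P -> Q p q.
Proof.
  intros Hstep p q Hp Hq.
  apply (finite_induction (fun a b : pt * pt => dist (fst a) (snd a) < dist (fst b) (snd b))
           (list_prod P P) (fun a => Q (fst a) (snd a))) with (a := (p, q)).
  - intros; lra.
  - intros; lra.
  - intros [a b] Hab IH; simpl in *; apply in_prod_iff in Hab.
    apply Hstep; try tauto.
    intros p' q' Hp' Hq' Hlt; apply (IH (p', q')); [apply in_prod|]; assumption.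
  - apply in_prod; assumption.
Qed.

(** * Frames and short edges *)

(* Rigid coordinates together with a linear order that refines the height fy and does
   not separate points of one cone; ties of fy are broken so as to match the half-open
   cones. *)
Record frame (m : nat) (fx fy : pt -> R) (lo : pt -> pt -> Prop) : Prop := {
  frame_dist : forall p q, dist p q ^ 2 = (fx q - fx p) ^ 2 + (fy q - fy p) ^ 2;
  frame_irrefl : forall p, ~ lo p p;
  frame_trans : forall p q r, lo p q -> lo q r -> lo p r;
  frame_total : forall p q, p = q \/ lo p q \/ lo q p;
  frame_height : forall p q, lo p q -> fy p <= fy q;
  frame_cone_below : forall j p q x,
    cone m j p q -> cone m j p x -> lo q p -> lo x p;
  frame_cone_above : forall j p q x,
    cone m j p q -> cone m j p x -> lo p q -> lo p x }.

Lemma frame_mirror m fx fy lo :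
  frame m fx fy lo -> frame m (fun p => - fx p) fy lo.
Proof.
  intros [H1 H2 H3 H4 H5 H6 H7]; split; try assumption.
  intros p q; rewrite H1; ring.
Qed.

(** * Plane inequalities for lenses and for two vectors of one cone *)

(** Read with [p] as origin, [s = (X, Y)], [s1 = (c1, d1)], [z = (a, b)] and [q = (A1, -A2)]. That
    [z] lies in the disc about [s] through [p] bounds its distance to [q]. Its distance to [p] is
    bounded by comparing [z] with [s] around [s1], since [s - z] has nonnegative inner product with
    [s1]. *)
Lemma lens_nested X Y c1 d1 a b A1 A2 :
  0 < X -> 0 <= Y -> X <= A1 -> 0 <= A2 -> 0 <= d1 -> b <= 0 -> a <= X ->
  (X - c1) ^ 2 + (Y - d1) ^ 2 <= X ^ 2 + Y ^ 2 ->
  (X - a) ^ 2 + (Y - b) ^ 2 <= (X - c1) ^ 2 + (Y - d1) ^ 2 ->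
  (c1 - a) ^ 2 + (d1 - b) ^ 2 <= (X - c1) ^ 2 + (Y - d1) ^ 2 ->
  0 <= a /\ (a = 0 -> b = 0) /\ a ^ 2 + b ^ 2 <= X ^ 2 + Y ^ 2 /\
  (A1 - a) ^ 2 + (A2 + b) ^ 2 <= A1 ^ 2 + A2 ^ 2.
Proof.
  intros HX HY HXA HA2 Hd Hb HaX H1 H2 H3.
  assert (Ha : 0 <= a).
  { destruct (Rle_or_lt 0 a) as [H|H]; [exact H|exfalso; nra]. }
  assert (Hab : a = 0 -> b = 0).
  { intros ->; destruct (Rle_or_lt 0 b) as [H|H]; [lra|exfalso; nra]. }
  assert (Hdot : 0 <= (X - a) * c1 + (Y - b) * d1).
  { assert (0 <= X * c1 + Y * d1) by nra.
    destruct (Rle_or_lt 0 c1); nra. }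
  repeat split; [exact Ha|exact Hab|nra|nra].
Qed.

(** Seen from [q] with the horizontal axis reversed, [A] is [p] and [B] is [x]. The distance of [B]
    from the line of [A] is [|cr| / Rr], at most [l * h]. As [A1 <= B1], the component of [A - B]
    along [A] is controlled by the one across it, whence [A1 * D <= |cr|]. *)
Lemma near_bound A1 A2 B1 B2 Rr l D h mu :
  0 < Rr -> 0 < mu -> 0 <= l -> 0 <= h -> h <= 1 -> 0 <= D ->
  0 <= A2 -> mu * Rr <= A1 ->
  Rr ^ 2 = A1 ^ 2 + A2 ^ 2 -> l ^ 2 = B1 ^ 2 + B2 ^ 2 ->
  D ^ 2 = (A1 - B1) ^ 2 + (A2 - B2) ^ 2 ->
  D ^ 2 <= (Rr - l) ^ 2 + h ^ 2 * (Rr * l) ->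
  l <= Rr -> A1 <= B1 ->
  mu * D <= l * h.
Proof.
  intros HR Hmu Hl Hh Hh1 HD HA2 HA HRe Hle HDe HDh HlR HAB.
  set (d := A1 * B1 + A2 * B2).
  set (cr := A1 * B2 - A2 * B1).
  assert (Hid : d ^ 2 + cr ^ 2 = Rr ^ 2 * l ^ 2).
  { unfold d, cr; rewrite HRe, Hle; ring. }
  assert (HA1 : 0 < A1) by nra.
  assert (Hd : Rr * l * (1 - h ^ 2 / 2) <= d) by (unfold d; nra).
  assert (Hpos : 0 <= Rr * l) by nra.
  assert (Hcr : cr ^ 2 <= (Rr * l * h) ^ 2).
  { assert (0 <= Rr * l * (1 - h ^ 2 / 2)) by (apply Rmult_le_pos; nra).
    assert ((Rr * l * (1 - h ^ 2 / 2)) ^ 2 <= d ^ 2) by (apply sqr_le; assumption).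
    assert (0 <= (Rr * l) ^ 2 * (h ^ 2) ^ 2) by (apply Rmult_le_pos; apply pow2_ge_0).
    nra. }
  assert (Hperp : (Rr ^ 2 - d) * A1 <= - cr * A2).
  { replace ((Rr ^ 2 - d) * A1) with (- cr * A2 + Rr ^ 2 * (A1 - B1))
      by (unfold d, cr; rewrite HRe; ring).
    nra. }
  assert (Hge : 0 <= Rr ^ 2 - d).
  { assert (d <= Rr * l) by (apply le_of_sqr_le; nra). nra. }
  assert (Hsq : ((Rr ^ 2 - d) * A1) ^ 2 <= (- cr * A2) ^ 2)
    by (apply sqr_le; [apply Rmult_le_pos; lra|exact Hperp]).
  assert (HDid : Rr ^ 2 * D ^ 2 = (Rr ^ 2 - d) ^ 2 + cr ^ 2).
  { rewrite HDe; unfold d, cr; rewrite HRe; ring. }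
  assert (Hfin : Rr ^ 2 * (A1 * D) ^ 2 <= Rr ^ 2 * cr ^ 2).
  { replace (Rr ^ 2 * (A1 * D) ^ 2) with (A1 ^ 2 * (Rr ^ 2 * D ^ 2)) by ring.
    rewrite HDid.
    replace (A1 ^ 2 * ((Rr ^ 2 - d) ^ 2 + cr ^ 2))
      with (((Rr ^ 2 - d) * A1) ^ 2 + A1 ^ 2 * cr ^ 2) by ring.
    replace (Rr ^ 2 * cr ^ 2) with ((- cr * A2) ^ 2 + A1 ^ 2 * cr ^ 2)
      by (rewrite HRe; ring).
    lra. }
  assert (HR2 : 0 < Rr ^ 2) by nra.
  assert (H1 : (A1 * D) ^ 2 <= cr ^ 2)
    by (apply Rmult_le_reg_l with (Rr ^ 2); assumption).
  assert (H2 : A1 * D <= Rr * l * h).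
  { apply le_of_sqr_le; [apply Rmult_le_pos; assumption|lra]. }
  assert (H3 : mu * Rr * D <= A1 * D) by (apply Rmult_le_compat_r; assumption).
  apply Rmult_le_reg_l with Rr; [exact HR|]. lra.
Qed.

(** Divided by [Rr * l], the claim compares coordinates of two unit vectors, whose distance is at
    most [h] by the law of cosines. *)
Lemma unit_vector_gap A1 A2 B1 B2 Rr l D h :
  0 < Rr -> 0 < l -> 0 <= h ->
  Rr ^ 2 = A1 ^ 2 + A2 ^ 2 -> l ^ 2 = B1 ^ 2 + B2 ^ 2 ->
  D ^ 2 = (A1 - B1) ^ 2 + (A2 - B2) ^ 2 ->
  D ^ 2 <= (Rr - l) ^ 2 + h ^ 2 * (Rr * l) ->
  l * A1 - Rr * B1 <= Rr * l * h /\ Rr * B2 - l * A2 <= Rr * l * h.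
Proof.
  intros HR Hl Hh HRe Hle HDe HDh.
  assert (Hpos : 0 < Rr * l) by (apply Rmult_lt_0_compat; assumption).
  assert (Hd : Rr * l * (2 - h ^ 2) <= 2 * (A1 * B1 + A2 * B2)) by nra.
  assert (Hdiff : (Rr * B1 - l * A1) ^ 2 + (Rr * B2 - l * A2) ^ 2 <= (Rr * l * h) ^ 2).
  { replace ((Rr * B1 - l * A1) ^ 2 + (Rr * B2 - l * A2) ^ 2)
      with (Rr ^ 2 * (B1 ^ 2 + B2 ^ 2) + l ^ 2 * (A1 ^ 2 + A2 ^ 2)
            - 2 * (Rr * l) * (A1 * B1 + A2 * B2)) by ring.
    rewrite <- HRe, <- Hle. nra. }
  assert (Hpos' : 0 <= Rr * l * h) by (apply Rmult_le_pos; lra).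
  pose proof (pow2_ge_0 (Rr * B1 - l * A1)).
  pose proof (pow2_ge_0 (Rr * B2 - l * A2)).
  split; apply le_of_sqr_le; nra.
Qed.

(** Again [A] is [p] and [B] is [x], now not below [p]. The horizontal distance [A1 - B1] is what
    remains to be descended, so the last bound says that an edge of length [l] saves almost its full
    length. *)
Lemma advance_bound A1 A2 B1 B2 Rr l D h mu :
  0 < Rr -> 0 < l -> 0 <= h -> h <= mu ->
  0 <= A2 -> A2 <= B2 -> mu * Rr <= A1 ->
  Rr ^ 2 = A1 ^ 2 + A2 ^ 2 -> l ^ 2 = B1 ^ 2 + B2 ^ 2 ->
  D ^ 2 = (A1 - B1) ^ 2 + (A2 - B2) ^ 2 ->
  D ^ 2 <= (Rr - l) ^ 2 + h ^ 2 * (Rr * l) ->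
  l <= Rr ->
  0 <= B1 <= A1 /\ B2 - A2 <= h * l /\ l * (1 - h) <= Rr - (A1 - B1).
Proof.
  intros HR Hl Hh Hmu HA2 HAB HA HRe Hle HDe HDh HlR.
  destruct (unit_vector_gap A1 A2 B1 B2 Rr l D h) as [H1 H2]; try assumption.
  assert (Hpos : 0 < Rr * l) by (apply Rmult_lt_0_compat; assumption).
  assert (HA1 : 0 <= A1) by nra.
  assert (HA1R : A1 <= Rr) by (apply le_of_sqr_le; nra).
  repeat split.
  - apply Rmult_le_reg_l with Rr; [exact HR|]. rewrite Rmult_0_r.
    assert (l * (mu * Rr) <= l * A1) by (apply Rmult_le_compat_l; lra).
    assert (Rr * l * h <= Rr * l * mu) by (apply Rmult_le_compat_l; lra).
    lra.
  - apply le_of_sqr_le; [exact HA1|]. nra.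
  - apply Rmult_le_reg_l with Rr; [exact HR|].
    assert (l * A2 <= Rr * A2) by (apply Rmult_le_compat_r; lra). lra.
  - apply Rmult_le_reg_l with Rr; [exact HR|].
    assert (l * (Rr - A1) <= Rr * (Rr - A1)) by (apply Rmult_le_compat_r; lra). lra.
Qed.

Lemma flat_same_cone A1 A2 B1 B2 Rr l D h :
  0 < Rr -> 0 < l -> 0 <= h <= 0.0755 -> 0 <= A2 <= A1 ->
  Rr ^ 2 = A1 ^ 2 + A2 ^ 2 -> l ^ 2 = B1 ^ 2 + B2 ^ 2 ->
  D ^ 2 = (A1 - B1) ^ 2 + (A2 - B2) ^ 2 ->
  D ^ 2 <= (Rr - l) ^ 2 + h ^ 2 * (Rr * l) ->
  0.63 * l <= B1.
Proof.
  intros HR Hl Hh HA HRe Hle HDe HDh.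
  destruct (unit_vector_gap A1 A2 B1 B2 Rr l D h) as [H1 _]; try assumption; [lra|].
  assert (Hpos : 0 < Rr * l) by (apply Rmult_lt_0_compat; assumption).
  assert (HA1 : 0.7071 * Rr <= A1) by (apply le_of_sqr_le; nra).
  apply Rmult_le_reg_l with Rr; [exact HR|].
  assert (l * (0.7071 * Rr) <= l * A1) by (apply Rmult_le_compat_l; lra).
  assert (Rr * l * h <= Rr * l * 0.0755) by (apply Rmult_le_compat_l; lra).
  lra.
Qed.

(** * Yao and Yao-Yao choices *)

Lemma yao_nearest P m Ysel (HY : yao_selection P m Ysel) p j x :
  In p P -> (j < m)%nat -> In x P -> cone m j p x ->
  exists q, Ysel p j = Some q /\ In q P /\ cone m j p q /\ dist p q <= dist p x.
Proof.
  intros Hp Hj Hx Hcx; destruct (HY p j Hp Hj) as [Hnone Hsome].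
  destruct (Ysel p j) as [q|].
  - destruct (Hsome q eq_refl) as [Hq [Hcq Hmin]].
    exists q; split; [reflexivity|]; split; [exact Hq|]; split; [exact Hcq|].
    apply Hmin; assumption.
  - exfalso; apply (proj1 Hnone eq_refl); exists x; tauto.
Qed.

Lemma yaoyao_nearest P m Ysel YYsel (HY : yao_selection P m Ysel)
    (HYY : yaoyao_selection P m Ysel YYsel) p j j' q :
  In p P -> (j < m)%nat -> Ysel p j = Some q -> (j' < m)%nat -> cone m j' q p ->
  exists x, In x P /\ cone m j' q x /\ dist q x <= dist q p /\
    yaoyao_edge P m Ysel YYsel x q.
Proof.
  intros Hp Hj Hs Hj' Hopp.
  destruct (HY p j Hp Hj) as [_ Hsome]; destruct (Hsome q Hs) as [Hq _].
  assert (He : yao_edge P m Ysel p q) by (split; [exact Hp|exists j; tauto]).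
  destruct (HYY q j' Hq Hj') as [Hn2 Hs2].
  destruct (YYsel q j') as [x|] eqn:Hx.
  - destruct (Hs2 x eq_refl) as [HxP [Hcx [_ Hmin]]].
    exists x; refine (conj HxP (conj Hcx (conj _ _))).
    + apply Hmin; assumption.
    + split; [exact Hq|exists j'; tauto].
  - exfalso; apply (proj1 Hn2 eq_refl); exists p; tauto.
Qed.

(** * Paths that replace short Yao edges *)

Section ShortEdges.

(** [h] is the cone angle, [t] the ratio available for smaller distances, [c] the ratio claimed for
    a short edge. *)
Context (P : list pt) (m : nat) (Ysel YYsel : pt -> nat -> option pt) (h t c : R).
Context (HY : yao_selection P m Ysel) (HYY : yaoyao_selection P m Ysel YYsel).
Context (cone_cover : forall p q, q <> p -> exists j, (j < m)%nat /\ cone m j p q).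
Context (cone_opposite : forall j p, (j < m)%nat ->
  exists j', (j' < m)%nat /\ forall q, cone m j p q -> cone m j' q p).
Context (cone_narrow : forall j p q x, cone m j p q -> cone m j p x ->
  dist q x ^ 2 <= (dist p q - dist p x) ^ 2 + h ^ 2 * (dist p q * dist p x)).
Context (Hh : 0 < h <= 0.0755) (Ht : 0 < t) (Hc : 0 <= c <= 0.36 * t).
(** Per unit of [dist q x]: the Yao-Yao edge costs 1, the height of [x] over [p], or its distance
    from [p] when below, costs at most [1.6 * t * h], and the advance towards [p] earns at least
    [c * (1 - h)]. *)
Context (Hbudget : 1 + 1.6 * t * h <= c * (1 - h)).

Let E := yaoyao_edge P m Ysel YYsel.

(* No point below and to the right of p in the lens of p and q.  Unlike emptiness of a
   whole quadrant, this is inherited by the shorter mirrored edges (gap_nested). *)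
Definition gap (fx : pt -> R) (lo : pt -> pt -> Prop) (p q : pt) : Prop :=
  forall z, In z P -> lo z p -> fx p < fx z ->
    dist p z < dist p q -> dist q z <= dist p q -> False.

(* The slope condition with 0.63 < 1/sqrt 2 - 0.0755 admits all directions within one
   cone of a direction of slope at most 45 degrees. *)
Definition short (p q : pt) : Prop :=
  forall fx fy lo j, frame m fx fy lo -> (j < m)%nat -> Ysel p j = Some q ->
    lo q p -> 0.63 * dist p q <= fx q - fx p -> gap fx lo p q ->
    linked E p q (c * dist p q).

Lemma same_cone_closer j p q x :
  cone m j p q -> cone m j p x -> dist p x <= dist p q -> dist q x <= dist p q.
Proof.
  intros Hq Hx Hle; pose proof (cone_narrow _ _ _ _ Hq Hx) as Hn.
  pose proof (dist_nonneg p x); pose proof (dist_nonneg p q).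
  apply le_of_sqr_le; [assumption|].
  assert (h ^ 2 <= 1) by nra.
  assert (0 <= dist p q * dist p x) by (apply Rmult_le_pos; assumption).
  nra.
Qed.

Lemma same_cone_strictly_closer j p q x :
  cone m j p q -> cone m j p x -> dist p x <= dist p q -> dist q x < dist p q.
Proof.
  intros Hq Hx Hle; pose proof (cone_narrow _ _ _ _ Hq Hx) as Hn.
  assert (0 < dist p x) by (apply dist_pos; intros ->; apply (proj1 Hx); reflexivity).
  apply lt_of_sqr_lt; [lra|].
  assert (h ^ 2 < 1) by nra.
  assert (0 < dist p q * dist p x) by (apply Rmult_lt_0_compat; lra).
  nra.
Qed.

Section Step.

Context (p q : pt) (fx fy : pt -> R) (lo : pt -> pt -> Prop).
Context (Hp : In p P) (Hq : In q P) (HF : frame m fx fy lo) (Hqp : lo q p).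
Context (Hflat : 0.63 * dist p q <= fx q - fx p) (Hgap : gap fx lo p q).
Context (near : forall p' q', In p' P -> In q' P -> dist p' q' < dist p q ->
  linked E p' q' (t * dist p' q')).
Context (IH : forall p' q', In p' P -> In q' P -> dist p' q' < dist p q ->
  short p' q').

(** By [lens_nested], such a [z] would lie in the lens of [p] and [q] that [gap] keeps empty. The
    lemma serves twice: with [s1] the next point of the descent and [z] the Yao choice, then with
    [s1] the Yao choice and [z] in the lens of the new edge. *)
Lemma gap_nested s s1 z :
  In z P -> lo p s -> p = s1 \/ lo p s1 -> 0 < fx s - fx p <= fx q - fx p ->
  dist p s < dist p q -> dist s s1 <= dist s p ->
  lo z p -> dist s z <= dist s s1 -> dist s1 z <= dist s s1 -> fx z <= fx s ->
  False.
Proof.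
  intros Hz Hps Hps1 HX Hs Hss1 Hzp Hsz Hs1z Hzs.
  pose proof (frame_height _ _ _ _ HF _ _ Hps) as HYs.
  pose proof (frame_height _ _ _ _ HF _ _ Hzp) as HYz.
  pose proof (frame_height _ _ _ _ HF _ _ Hqp) as HYq.
  assert (HYs1 : fy p <= fy s1).
  { destruct Hps1 as [<-|Hps1]; [lra|exact (frame_height _ _ _ _ HF _ _ Hps1)]. }
  pose proof (frame_dist _ _ _ _ HF) as HD.
  pose proof (sqr_le _ _ (dist_nonneg _ _) Hss1) as E1.
  pose proof (sqr_le _ _ (dist_nonneg _ _) Hsz) as E2.
  pose proof (sqr_le _ _ (dist_nonneg _ _) Hs1z) as E3.
  rewrite !HD in E1, E2, E3.
  destruct (lens_nested (fx s - fx p) (fy s - fy p) (fx s1 - fx p) (fy s1 - fy p)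
              (fx z - fx p) (fy z - fy p) (fx q - fx p) (fy p - fy q))
    as [L1 [L2 [L3 L4]]]; try lra.
  apply (Hgap z Hz Hzp).
  - destruct L1 as [L1|L1]; [lra|exfalso].
    assert (Hzp' : dist p z ^ 2 = 0).
    { rewrite HD, <- L1, L2 by lra; ring. }
    apply (frame_irrefl _ _ _ _ HF p).
    replace p with z at 1; [exact Hzp|].
    apply NNPP; intros Hne; assert (0 < dist p z) by (apply dist_pos; congruence); nra.
  - apply Rle_lt_trans with (dist p s); [|exact Hs].
    apply le_of_sqr_le; [apply dist_nonneg|]; rewrite !HD; lra.
  - apply le_of_sqr_le; [apply dist_nonneg|]; rewrite !HD; lra.
Qed.

Lemma norm_bound a b :
  a ^ 2 <= b ^ 2 -> 0 <= b -> forall d, d ^ 2 = a ^ 2 + b ^ 2 -> d <= 1.42 * b.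
Proof. intros; apply le_of_sqr_le; nra. Qed.

(* Horizontal distance costs c, height costs 1.6 t: the latter covers a steep step
   bounded by t times its length, and 1.6 > 1 / 0.63 covers the points close to p. *)
Lemma descent s :
  In s P -> p = s \/ lo p s -> 0 <= fx s - fx p <= fx q - fx p ->
  dist p s < dist p q ->
  linked E p s (c * (fx s - fx p) + 1.6 * t * (fy s - fy p)).
Proof.
  pose proof (frame_dist _ _ _ _ HF) as HD.
  revert s.
  refine (finite_induction lo P _ (frame_irrefl _ _ _ _ HF) (frame_trans _ _ _ _ HF) _).
  intros s Hs IHs [<-|Hps] HX Hds.
  { apply linked_le with 0; [apply linked_refl|nra]. }
  pose proof (frame_height _ _ _ _ HF _ _ Hps) as HYs.
  pose proof (HD p s) as Eps.
  pose proof (dist_nonneg p s) as Nps.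
  (* From 45 degrees upwards the bound for smaller distances suffices, as
     [sqrt 2 <= 1.42 <= 1.6]. *)
  destruct (Rle_or_lt (fx s - fx p) (fy s - fy p)) as [Hsteep|HXY].
  { apply linked_le with (t * dist p s); [apply near; assumption|].
    assert (dist p s <= 1.42 * (fy s - fy p))
      by (apply (norm_bound (fx s - fx p)); nra).
    nra. }
  (* Only points not below [p] compete, which keeps the descent above [p]; [p] itself is a
     candidate. *)
  destruct (exists_nearest P s (fun z => (p = z \/ lo p z) /\ lo z s /\ fx z <= fx s))
    as [s' [Hs' [[Hps' [Hs's Hxs']] Hmin]]].
  { exists p; repeat split; [exact Hp|left; reflexivity|exact Hps|lra]. }
  assert (Hss' : dist s s' <= dist s p).
  { apply Hmin; [exact Hp|]; repeat split; [left; reflexivity|exact Hps|lra]. }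
  assert (HYs' : fy p <= fy s').
  { destruct Hps' as [<-|Hps']; [lra|exact (frame_height _ _ _ _ HF _ _ Hps')]. }
  pose proof (frame_height _ _ _ _ HF _ _ Hs's) as HYs's.
  pose proof (HD s s') as Ess'.
  destruct (Rlt_or_le (fx s - fx s') (fy s - fy s')) as [Hst|Hfl].
  - apply linked_le with ((c * (fx s' - fx p) + 1.6 * t * (fy s' - fy p)) + t * dist s' s).
    + apply linked_trans with s'.
      * apply IHs; try assumption; [lra|].
        apply Rle_lt_trans with (dist p s); [|exact Hds].
        apply le_of_sqr_le; [exact Nps|]; rewrite !HD; nra.
      * apply near; try assumption.
        rewrite (dist_sym s' s); rewrite (dist_sym p s) in Hds; lra.
    + assert (dist s' s <= 1.42 * (fy s - fy s')).
      { rewrite dist_sym; apply (norm_bound (fx s - fx s')); [nra|lra|nra]. }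
      assert (c * (fx s' - fx p) <= c * (fx s - fx p))
        by (apply Rmult_le_compat_l; lra).
      nra.
  (* A flat step need not be a Yao edge. It is replaced by the Yao choice [r] of [s] in the cone of
     [s'], which is still flat and not below [p]; the edge from [s] to [r] is short in the mirrored
     frame. *)
  - assert (Hne : s' <> s).
    { intros ->; exact (frame_irrefl _ _ _ _ HF _ Hs's). }
    destruct (cone_cover s s' Hne) as [j [Hj Hcj]].
    destruct (yao_nearest P m Ysel HY s j s' Hs Hj Hs' Hcj) as [r [Hsel [Hr [Hcr Hsr]]]].
    pose proof (frame_cone_below _ _ _ _ HF _ _ _ _ Hcj Hcr Hs's) as Hrs.
    pose proof (cone_narrow _ _ _ _ Hcj Hcr) as Hnar.
    pose proof (same_cone_closer _ _ _ _ Hcj Hcr Hsr) as Hs'r.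
    assert (Hdr : 0 < dist s r).
    { apply dist_pos; intros ->; exact (frame_irrefl _ _ _ _ HF _ Hrs). }
    pose proof (HD s r) as Esr. pose proof (HD s' r) as Es'r.
    pose proof (frame_height _ _ _ _ HF _ _ Hrs) as HYrs.
    assert (Hrflat : 0.63 * dist s r <= fx s - fx r).
    { apply (flat_same_cone (fx s - fx s') (fy s - fy s') _ (fy s - fy r)
               (dist s s') _ (dist s' r) h); try lra; try (rewrite HD; ring). }
    assert (Hpr : p = r \/ lo p r).
    { destruct (frame_total _ _ _ _ HF p r) as [H|[H|H]]; [tauto|tauto|exfalso].
      apply (gap_nested s s' r); try assumption; lra. }
    assert (HYr : fy p <= fy r).
    { destruct Hpr as [<-|Hpr]; [lra|exact (frame_height _ _ _ _ HF _ _ Hpr)]. }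
    assert (Hlast : linked E r s (c * dist s r)).
    { apply linked_sym.
      apply (IH s r Hs Hr) with (fx := fun z => - fx z) (fy := fy) (lo := lo) (j := j).
      - rewrite (dist_sym p s) in Hds; lra.
      - apply frame_mirror; exact HF.
      - exact Hj.
      - exact Hsel.
      - exact Hrs.
      - lra.
      (* In the new lens, a point not below [p] would beat [s'], and a point below [p] is excluded
         by [gap_nested]. *)
      - intros z Hz Hzs Hxz Hsz Hrz.
        destruct (frame_total _ _ _ _ HF p z) as [Hpz|[Hpz|Hzp]].
        + assert (dist s s' <= dist s z); [|lra].
          apply Hmin; [exact Hz|]; repeat split; [left; exact Hpz|exact Hzs|lra].
        + assert (dist s s' <= dist s z); [|lra].
          apply Hmin; [exact Hz|]; repeat split; [right; exact Hpz|exact Hzs|lra].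
        + apply (gap_nested s r z); try assumption; lra. }
    destruct (Rle_or_lt 0 (fx r - fx p)) as [Hrx|Hrx].
    + apply linked_le with ((c * (fx r - fx p) + 1.6 * t * (fy r - fy p)) + c * dist s r).
      * apply linked_trans with r; [|exact Hlast].
        apply IHs; try assumption; [lra|].
        apply Rle_lt_trans with (dist p s); [|exact Hds].
        apply le_of_sqr_le; [exact Nps|]; rewrite !HD; nra.
      * assert (dist s r <= (fx s - fx r) + (fy s - fy r))
          by (apply le_of_sqr_le; nra).
        nra.
    (* Here [r] overshoots [p] to the left. It stays in the disc about [s] through [p], and [s] is
       seen from [p] below 45 degrees, so the overshoot is at most the height of [r] over [p]. *)
    + assert (Hrp : dist s r <= dist s p) by lra.
      pose proof (sqr_le _ _ (dist_nonneg _ _) Hrp) as Esrp.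
      rewrite !HD in Esrp.
      assert (Hleft : - (fx r - fx p) <= fy r - fy p) by nra.
      pose proof (HD p r) as Epr.
      assert (Hpr1 : dist p r <= 1.42 * (fy r - fy p))
        by (apply (norm_bound (fx r - fx p)); nra).
      apply linked_le with (t * dist p r + c * dist s r).
      * apply linked_trans with r; [|exact Hlast].
        apply near; try assumption.
        apply Rle_lt_trans with (dist p s); [|exact Hds].
        apply le_of_sqr_le; [exact Nps|]; rewrite !HD; nra.
      (* The costs of height fit exactly: [c / 2 <= 0.18 * t] and [1.42 + 0.18 = 1.6]. *)
      * assert (dist s r <= (fx s - fx p) + (fy s - fy p) / 2).
        { apply Rle_trans with (1 := Hrp); apply le_of_sqr_le; [lra|].
          rewrite HD; nra. }
        nra.
Qed.

Lemma short_step j : (j < m)%nat -> Ysel p j = Some q -> linked E p q (c * dist p q).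
Proof.
  intros Hj Hsel.
  pose proof (frame_dist _ _ _ _ HF) as HD.
  destruct (HY p j Hp Hj) as [_ Hsome]; destruct (Hsome q Hsel) as [_ [Hcq _]].
  destruct (cone_opposite j p Hj) as [j' [Hj' Hopp]].
  pose proof (Hopp q Hcq) as Hcp.
  destruct (yaoyao_nearest P m Ysel YYsel HY HYY p j j' q Hp Hj Hsel Hj' Hcp)
    as [x [Hx [Hcx [Hqx HE]]]].
  pose proof (cone_narrow _ _ _ _ Hcp Hcx) as Hnar.
  pose proof (same_cone_strictly_closer _ _ _ _ Hcp Hcx Hqx) as Hpx.
  assert (Hl : 0 < dist q x) by (apply dist_pos; intros ->; apply (proj1 Hcx); reflexivity).
  assert (Hlast : linked E x q (dist q x)).
  { rewrite dist_sym; apply linked_edge; left; exact HE. }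
  rewrite (dist_sym q p) in *.
  pose proof (frame_height _ _ _ _ HF _ _ Hqp) as HYq.
  assert (Hc1 : 1 + 1.6 * t * h <= c) by nra.
  destruct (frame_total _ _ _ _ HF p x) as [<-|[Hup|Hdown]].
  - apply linked_le with (1 := Hlast). rewrite (dist_sym q p).
    assert (0 <= 1.6 * t * h) by nra.
    assert (1 * dist p q <= c * dist p q)
      by (apply Rmult_le_compat_r; [apply dist_nonneg|lra]).
    lra.
  - pose proof (frame_height _ _ _ _ HF _ _ Hup) as HYx.
    destruct (advance_bound (fx q - fx p) (fy p - fy q) (fx q - fx x) (fy x - fy q)
      (dist p q) (dist q x) (dist p x) h 0.63) as [HB [HY1 HX1]];
      try lra; try (rewrite HD; ring).
    apply linked_le with ((c * (fx x - fx p) + 1.6 * t * (fy x - fy p)) + dist q x).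
    + apply linked_trans with x; [|exact Hlast].
      apply descent; [exact Hx|tauto|lra|exact Hpx].
    + assert (c * (dist q x * (1 - h)) <= c * (dist p q - (fx x - fx p)))
        by (apply Rmult_le_compat_l; lra).
      assert (1.6 * t * (fy x - fy p) <= 1.6 * t * (h * dist q x))
        by (apply Rmult_le_compat_l; lra).
      assert (dist q x * (1 + 1.6 * t * h) <= dist q x * (c * (1 - h)))
        by (apply Rmult_le_compat_l; lra).
      lra.
  - destruct (Rlt_or_le (fx p) (fx x)) as [Hright|Hleft].
    (* The narrow cone makes [x] strictly closer to [p] than [q] is, so [x] lies in the empty
       lens. *)
    { exfalso; apply (Hgap x); try assumption. }
    assert (Hn : 0.63 * dist p x <= dist q x * h).
    { apply (near_bound (fx q - fx p) (fy p - fy q) (fx q - fx x) (fy x - fy q)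
               (dist p q)); try lra; try (rewrite HD; ring).
      apply dist_nonneg. }
    apply linked_le with (t * dist p x + dist q x).
    + apply linked_trans with x; [apply near; assumption|exact Hlast].
    + assert (t * dist p x <= 1.6 * t * h * dist q x).
      { assert (dist p x <= 1.6 * (h * dist q x)) by nra. nra. }
      assert (dist q x * (1 + 1.6 * t * h) <= dist q x * c)
        by (apply Rmult_le_compat_l; lra).
      nra.
Qed.

End Step.

(** Inner induction on edge length, with the spanner bound below [d] held fixed. Length [d] itself
    is included because the first edge may be as long as the distance to the target. *)
Lemma short_edges d :
  (forall p q, In p P -> In q P -> dist p q < d -> linked E p q (t * dist p q)) ->
  forall p q, In p P -> In q P -> dist p q <= d -> short p q.
Proof.
  intros near.
  refine (distance_induction P _ _); intros p q Hp Hq IH Hd fx fy lo j HF Hj Hsel Hqp Hfl Hgap.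
  apply (short_step p q fx fy lo) with (j := j); try assumption.
  - intros p' q' Hp' Hq' Hlt; apply near; [assumption|assumption|lra].
  - intros p' q' Hp' Hq' Hlt; apply IH; [assumption..|lra].
Qed.

End ShortEdges.

(** * Cones *)

(** From [y - y^3 / 6 <= sin y = 1 / 2] at [y = PI / 6]. The precision is chosen so that
    [PI / 42 <= 0.0755]. *)
Lemma PI_le : PI <= 3.165.
Proof.
  pose proof PI_4; pose proof PI_RGT_0.
  destruct (pre_sin_bound (PI / 6) 0) as [Hb _]; [lra|lra|].
  rewrite sin_PI6 in Hb.
  unfold sin_approx in Hb; simpl in Hb; unfold sin_term in Hb; simpl in Hb.
  set (y := PI / 6) in *.
  assert (Hy : y - y ^ 3 / 6 <= 1 / 2) by (simpl; lra).
  destruct (Rle_or_lt y 0.5275) as [Hl|Hl]; [unfold y in Hl; lra|exfalso].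
  assert (y <= 2 / 3) by (unfold y; lra).
  assert (0 < (y - 0.5275) * (1 - (y ^ 2 + y * 0.5275 + 0.5275 ^ 2) / 6))
    by (apply Rmult_lt_0_compat; nra).
  lra.
Qed.

Lemma sin_le_id x : 0 <= x -> sin x <= x.
Proof.
  intros [Hx|<-]; [left; apply sin_lt_x; exact Hx|rewrite sin_0; lra].
Qed.

Lemma cos_lower x : 1 - x ^ 2 / 2 <= cos x.
Proof.
  assert (H : forall y, 0 <= y -> 1 - y ^ 2 / 2 <= cos y).
  { intros y Hy; replace y with (2 * (y / 2)) at 2 by field.
    rewrite cos_2a_sin.
    destruct (Rle_or_lt (y / 2) 1) as [H1|H1].
    - assert (0 <= sin (y / 2)).
      { apply sin_ge_0; [lra|pose proof PI2_3_2; lra]. }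
      pose proof (sin_le_id (y / 2) ltac:(lra)). nra.
    - pose proof (SIN_bound (y / 2)). nra. }
  destruct (Rle_or_lt 0 x) as [Hx|Hx]; [exact (H x Hx)|].
  rewrite <- cos_neg; replace (x ^ 2) with ((- x) ^ 2) by ring; apply H; lra.
Qed.

Lemma cos_sin_shift x (n : Z) :
  cos (x + 2 * IZR n * PI) = cos x /\ sin (x + 2 * IZR n * PI) = sin x.
Proof.
  assert (H : forall (y : R) (a : nat),
    cos (y + 2 * IZR (Z.of_nat a) * PI) = cos y /\
    sin (y + 2 * IZR (Z.of_nat a) * PI) = sin y).
  { intros y a; rewrite <- INR_IZR_INZ.
    split; [apply cos_period|apply sin_period]. }
  destruct (Z.le_gt_cases 0 n) as [Hn|Hn].
  - rewrite <- (Z2Nat.id n Hn); apply H.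
  - destruct (H (x + 2 * IZR n * PI) (Z.to_nat (- n))) as [Hc Hs].
    rewrite Z2Nat.id in Hc, Hs by lia.
    rewrite opp_IZR in Hc, Hs.
    replace (x + 2 * IZR n * PI + 2 * - IZR n * PI) with x in Hc, Hs by ring.
    split; symmetry; assumption.
Qed.

(** * Polar coordinates and rotated axes *)

(** The bounds range over all reals, so a union of consecutive cones across the positive horizontal
    axis is again one sector. *)
Definition sector (u : pt) (a b : R) (w : pt) : Prop :=
  exists r th, 0 < r /\ a <= th < b /\
    fst w = fst u + r * cos th /\ snd w = snd u + r * sin th.

Lemma sector_shift u a b w (n : Z) :
  sector u a b w -> sector u (a + 2 * IZR n * PI) (b + 2 * IZR n * PI) w.
Proof.
  intros [r [th [Hr [Hth [H1 H2]]]]].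
  exists r, (th + 2 * IZR n * PI).
  destruct (cos_sin_shift th n) as [-> ->].
  repeat split; (assumption || lra).
Qed.

Lemma sector_sub u a b a' b' w : a' <= a -> b <= b' -> sector u a b w -> sector u a' b' w.
Proof.
  intros Ha Hb [r [th [Hr [Hth H]]]]; exists r, th; split; [exact Hr|split; [lra|exact H]].
Qed.

Lemma polar_dist u w r th :
  0 < r -> fst w = fst u + r * cos th -> snd w = snd u + r * sin th -> dist u w = r.
Proof.
  intros Hr H1 H2.
  pose proof (sin2_cos2 th) as Hsc; unfold Rsqr in Hsc.
  assert (dist u w ^ 2 = r ^ 2).
  { rewrite dist_sqr, H1, H2.
    replace ((fst u + r * cos th - fst u) ^ 2 + (snd u + r * sin th - snd u) ^ 2)
      with (r ^ 2 * (sin th * sin th + cos th * cos th)) by ring.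
    rewrite Hsc; ring. }
  pose proof (dist_nonneg u w).
  apply Rle_antisym; apply le_of_sqr_le; lra.
Qed.

Lemma sector_neq u a b w : sector u a b w -> w <> u.
Proof.
  intros [r [th [Hr [_ [H1 H2]]]]] ->.
  pose proof (polar_dist _ _ _ _ Hr H1 H2) as Hd.
  rewrite dist_refl in Hd; lra.
Qed.

Lemma polar_right X Y : 0 < X ->
  exists r th, 0 < r /\ - (PI / 2) < th < PI / 2 /\ X = r * cos th /\ Y = r * sin th /\
    (0 <= Y -> 0 <= th) /\ (Y < 0 -> th < 0).
Proof.
  intros HX.
  set (T := Y / X).
  assert (Hs : 0 < sqrt (1 + T²)) by (apply sqrt_lt_R0; pose proof (Rle_0_sqr T); lra).
  assert (HXn : X <> 0) by lra.
  assert (HY : Y = X * T) by (unfold T; field; exact HXn).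
  exists (X * sqrt (1 + T²)), (atan T).
  rewrite cos_atan, sin_atan.
  split; [apply Rmult_lt_0_compat; assumption|].
  split; [pose proof (atan_bound T); lra|].
  split; [field; lra|].
  split; [rewrite HY; field; lra|].
  split; intros HY0.
  - assert (HT : 0 <= T) by nra.
    destruct HT as [HT|<-]; [|rewrite atan_0; lra].
    rewrite <- atan_0; left; apply atan_increasing; exact HT.
  - assert (HT : T < 0) by nra.
    rewrite <- atan_0; apply atan_increasing; exact HT.
Qed.

Definition axis_x (phi : R) (p : pt) : R := fst p * cos phi + snd p * sin phi.
Definition axis_y (phi : R) (p : pt) : R := - fst p * sin phi + snd p * cos phi.

Lemma axis_polar phi u w r th :
  fst w = fst u + r * cos th -> snd w = snd u + r * sin th ->
  axis_x phi w - axis_x phi u = r * cos (th - phi) /\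
  axis_y phi w - axis_y phi u = r * sin (th - phi).
Proof.
  intros H1 H2; unfold axis_x, axis_y; rewrite H1, H2, cos_minus, sin_minus.
  split; ring.
Qed.

Lemma axis_inverse phi u w r th :
  axis_x phi w - axis_x phi u = r * cos th ->
  axis_y phi w - axis_y phi u = r * sin th ->
  fst w = fst u + r * cos (phi + th) /\ snd w = snd u + r * sin (phi + th).
Proof.
  unfold axis_x, axis_y; intros H1 H2.
  pose proof (sin2_cos2 phi) as Hsc; unfold Rsqr in Hsc.
  rewrite cos_plus, sin_plus.
  assert (E1 : (fst w - fst u) * (sin phi * sin phi + cos phi * cos phi)
               = r * cos th * cos phi - r * sin th * sin phi)
    by (rewrite <- H1, <- H2; ring).
  assert (E2 : (snd w - snd u) * (sin phi * sin phi + cos phi * cos phi)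
               = r * cos th * sin phi + r * sin th * cos phi)
    by (rewrite <- H1, <- H2; ring).
  rewrite Hsc in E1, E2. split; lra.
Qed.

(** Quarter turns of the axes bring [w] into the open right half-plane of [u], where the arctangent
    gives the angle. *)
Lemma polar_exists u w : w <> u ->
  exists r th, 0 < r /\ fst w = fst u + r * cos th /\ snd w = snd u + r * sin th.
Proof.
  intros Hne.
  assert (H : forall phi, 0 < axis_x phi w - axis_x phi u ->
    exists r th, 0 < r /\ fst w = fst u + r * cos th /\ snd w = snd u + r * sin th).
  { intros phi HX.
    destruct (polar_right _ (axis_y phi w - axis_y phi u) HX)
      as [r [th [Hr [_ [H1 [H2 _]]]]]].
    exists r, (phi + th); split; [exact Hr|]; apply axis_inverse; assumption. }
  destruct (Rtotal_order (fst w) (fst u)) as [H1|[H1|H1]].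
  - apply (H PI); unfold axis_x; rewrite cos_PI, sin_PI; lra.
  - destruct (Rtotal_order (snd w) (snd u)) as [H2|[H2|H2]].
    + apply (H (- (PI / 2))); unfold axis_x.
      rewrite cos_neg, sin_neg, cos_PI2, sin_PI2; lra.
    + exfalso; apply Hne; destruct w, u; simpl in *; congruence.
    + apply (H (PI / 2)); unfold axis_x; rewrite cos_PI2, sin_PI2; lra.
  - apply (H 0); unfold axis_x; rewrite cos_0, sin_0; lra.
Qed.

(** A cone contains its ray of smaller angle: the ray in direction [phi] belongs to the cone above
    the line, the opposite ray to the cone below it. The tie rule follows this. *)
Definition axis_lo (phi : R) (p q : pt) : Prop :=
  axis_y phi p < axis_y phi q \/
  axis_y phi p = axis_y phi q /\ axis_x phi p < axis_x phi q.

Lemma axis_dist phi p q :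
  dist p q ^ 2 = (axis_x phi q - axis_x phi p) ^ 2 + (axis_y phi q - axis_y phi p) ^ 2.
Proof.
  rewrite dist_sqr; unfold axis_x, axis_y.
  pose proof (sin2_cos2 phi) as Hsc; unfold Rsqr in Hsc.
  transitivity (((fst q - fst p) ^ 2 + (snd q - snd p) ^ 2)
                * (sin phi * sin phi + cos phi * cos phi)); [rewrite Hsc; ring|ring].
Qed.

(** * The [2 * k] cones and their symmetries *)

Section Cones.

Context (k : nat) (Hk : (0 < k)%nat).
Let theta := PI / INR k.

Lemma INR_k_pos : 0 < INR k.
Proof. apply lt_0_INR; exact Hk. Qed.

Lemma theta_pos : 0 < theta.
Proof. apply Rdiv_lt_0_compat; [apply PI_RGT_0|exact INR_k_pos]. Qed.

Lemma k_theta : IZR (Z.of_nat k) * theta = PI.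
Proof.
  rewrite <- INR_IZR_INZ; unfold theta; field.
  pose proof INR_k_pos; lra.
Qed.

(** All integers are allowed as indices, with period [2 * k], so that runs of consecutive cones
    never wrap around. *)
Definition zcone (n : Z) (u w : pt) : Prop :=
  sector u (IZR n * theta) (IZR (n + 1) * theta) w.

Lemma cone_zcone j u w : cone (2 * k) j u w <-> zcone (Z.of_nat j) u w.
Proof.
  pose proof INR_k_pos as HI.
  assert (Ha : 2 * INR j * PI / INR (2 * k) = IZR (Z.of_nat j) * theta).
  { rewrite mult_INR, <- INR_IZR_INZ; unfold theta; simpl; field; lra. }
  assert (Hb : 2 * INR (S j) * PI / INR (2 * k) = IZR (Z.of_nat j + 1) * theta).
  { rewrite plus_IZR, mult_INR, <- INR_IZR_INZ, S_INR; unfold theta; simpl; field; lra. }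
  unfold cone, in_cone, zcone; rewrite Ha, Hb.
  split; [intros [_ H]; exact H|].
  intros H; split; [exact (sector_neq _ _ _ _ H)|exact H].
Qed.

Lemma zcone_shift n a u w : zcone n u w -> zcone (n + a * (2 * Z.of_nat k)) u w.
Proof.
  intros H; apply (sector_shift _ _ _ _ a) in H; unfold zcone.
  pose proof k_theta as Hkt.
  replace (IZR (n + a * (2 * Z.of_nat k)) * theta) with (IZR n * theta + 2 * IZR a * PI).
  2:{ rewrite !plus_IZR, !mult_IZR, <- Hkt; ring. }
  replace (IZR (n + a * (2 * Z.of_nat k) + 1) * theta)
    with (IZR (n + 1) * theta + 2 * IZR a * PI).
  2:{ rewrite !plus_IZR, !mult_IZR, <- Hkt; ring. }
  exact H.
Qed.

Definition cone_index (n : Z) : nat := Z.to_nat (n mod (2 * Z.of_nat k)).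

Lemma cone_index_lt n : (cone_index n < 2 * k)%nat.
Proof.
  unfold cone_index.
  pose proof (Z.mod_pos_bound n (2 * Z.of_nat k) ltac:(lia)); lia.
Qed.

Lemma zcone_cone_index n u w : zcone n u w <-> cone (2 * k) (cone_index n) u w.
Proof.
  rewrite cone_zcone; unfold cone_index.
  pose proof (Z.mod_pos_bound n (2 * Z.of_nat k) ltac:(lia)) as Hm.
  rewrite Z2Nat.id by lia.
  pose proof (Z.div_mod n (2 * Z.of_nat k) ltac:(lia)) as Hdm.
  split; intros H.
  - apply (zcone_shift _ (- (n / (2 * Z.of_nat k)))) in H.
    replace (n mod (2 * Z.of_nat k))%Z
      with (n + - (n / (2 * Z.of_nat k)) * (2 * Z.of_nat k))%Z by lia.
    exact H.
  - apply (zcone_shift _ (n / (2 * Z.of_nat k))) in H.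
    replace (n mod (2 * Z.of_nat k) + n / (2 * Z.of_nat k) * (2 * Z.of_nat k))%Z
      with n in H by lia.
    exact H.
Qed.

Lemma sector_zcone i j u w :
  sector u (IZR i * theta) (IZR j * theta) w ->
  exists n, (i <= n < j)%Z /\ zcone n u w.
Proof.
  intros [r [th [Hr [Hth H]]]]; pose proof theta_pos as Ht.
  set (n := Zfloor (th / theta)).
  destruct (Zfloor_bound (th / theta)) as [Hl Hu]; fold n in Hl, Hu.
  assert (Hl' : IZR n * theta <= th).
  { apply Rmult_le_compat_r with (r := theta) in Hl; [|lra].
    replace (th / theta * theta) with th in Hl by (field; lra). exact Hl. }
  assert (Hu' : th < IZR (n + 1) * theta).
  { apply Rmult_lt_compat_r with (r := theta) in Hu; [|lra].
    replace (th / theta * theta) with th in Hu by (field; lra).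
    rewrite plus_IZR; exact Hu. }
  exists n; split.
  - split.
    + apply Z.lt_succ_r; unfold Z.succ; apply lt_IZR.
      apply Rmult_lt_reg_r with theta; lra.
    + apply lt_IZR; apply Rmult_lt_reg_r with theta; lra.
  - exists r, th; tauto.
Qed.

Lemma zcone_sector i j n u w :
  (i <= n < j)%Z -> zcone n u w -> sector u (IZR i * theta) (IZR j * theta) w.
Proof.
  intros Hn; pose proof theta_pos.
  apply sector_sub; apply Rmult_le_compat_r; try lra; apply IZR_le; lia.
Qed.

Lemma zcone_exists u w : w <> u -> exists n, zcone n u w.
Proof.
  intros Hne; destruct (polar_exists u w Hne) as [r [th [Hr H]]].
  pose proof theta_pos as Ht.
  destruct (sector_zcone (Zfloor (th / theta)) (Zfloor (th / theta) + 1) u w) as [n [_ Hn]].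
  - exists r, th; split; [exact Hr|split; [|exact H]].
    destruct (Zfloor_bound (th / theta)) as [Hl Hu].
    replace th with (th / theta * theta) at 2 3 by (field; lra).
    rewrite plus_IZR; split; [apply Rmult_le_compat_r|apply Rmult_lt_compat_r]; lra.
  - exists n; exact Hn.
Qed.

Lemma cone_cover p q : q <> p -> exists j, (j < 2 * k)%nat /\ cone (2 * k) j p q.
Proof.
  intros Hne; destruct (zcone_exists p q Hne) as [n Hn].
  exists (cone_index n); split; [apply cone_index_lt|apply zcone_cone_index; exact Hn].
Qed.

(** [k] cones make a half turn, so the reversed vector lies exactly in the cone [k] places further;
    this uses that the number of cones is even. *)
Lemma cone_opposite j p : (j < 2 * k)%nat ->
  exists j', (j' < 2 * k)%nat /\ forall q, cone (2 * k) j p q -> cone (2 * k) j' q p.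
Proof.
  intros Hj; exists (cone_index (Z.of_nat j + Z.of_nat k)).
  split; [apply cone_index_lt|].
  intros q Hq; apply cone_zcone in Hq; apply zcone_cone_index.
  destruct Hq as [r [th [Hr [Hth [H1 H2]]]]].
  pose proof k_theta as Hkt.
  exists r, (th + PI); split; [exact Hr|].
  rewrite !plus_IZR in *.
  split; [lra|].
  rewrite neg_cos, neg_sin, H1, H2; split; ring.
Qed.

(** Law of cosines with [cos d >= 1 - d^2 / 2] for an angular difference of at most [theta]. *)
Lemma cone_narrow j p q x : cone (2 * k) j p q -> cone (2 * k) j p x ->
  dist q x ^ 2 <= (dist p q - dist p x) ^ 2 + theta ^ 2 * (dist p q * dist p x).
Proof.
  intros Hq Hx; apply cone_zcone in Hq, Hx.
  destruct Hq as [r [th [Hr [Hth [H1 H2]]]]].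
  destruct Hx as [s [ph [Hs [Hph [H3 H4]]]]].
  rewrite (polar_dist _ _ _ _ Hr H1 H2), (polar_dist _ _ _ _ Hs H3 H4).
  rewrite dist_sqr, H1, H2, H3, H4.
  rewrite plus_IZR in Hth, Hph.
  pose proof (cos_lower (th - ph)) as Hc; rewrite cos_minus in Hc.
  assert (Hd : (th - ph) ^ 2 <= theta ^ 2) by (apply pow_maj_Rabs, Rabs_le; lra).
  pose proof (sin2_cos2 th) as E1; pose proof (sin2_cos2 ph) as E2.
  unfold Rsqr in E1, E2.
  replace ((fst p + s * cos ph - (fst p + r * cos th)) ^ 2
           + (snd p + s * sin ph - (snd p + r * sin th)) ^ 2)
    with (s ^ 2 * (sin ph * sin ph + cos ph * cos ph)
          + r ^ 2 * (sin th * sin th + cos th * cos th)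
          - 2 * (r * s) * (cos th * cos ph + sin th * sin ph)) by ring.
  rewrite E1, E2.
  assert (0 < r * s) by (apply Rmult_lt_0_compat; assumption).
  nra.
Qed.

(* A line through p in direction i * theta is a union of cone boundaries, so each
   cone lies on one side of it. *)
Lemma zcone_side i n : exists up : bool, forall p q, zcone n p q ->
  if up then axis_lo (IZR i * theta) p q else axis_lo (IZR i * theta) q p.
Proof.
  set (K := Z.of_nat k). pose proof theta_pos as Ht. pose proof k_theta as Hkt.
  fold K in Hkt.
  (* [N] counts the half turns from direction [i] to cone [n]; its parity decides the side. *)
  set (N := ((n - i) / K)%Z).
  assert (HN : (N * K <= n - i /\ n - i + 1 <= N * K + K)%Z).
  { unfold N; pose proof (Z.div_mod (n - i) K ltac:(lia)).
    pose proof (Z.mod_pos_bound (n - i) K ltac:(lia)). lia. }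
  exists (Z.even N); intros p q [r [th [Hr [Hth [H1 H2]]]]].
  destruct (axis_polar (IZR i * theta) p q r th H1 H2) as [Hx Hy].
  set (tau := th - IZR i * theta - IZR N * PI).
  assert (Htau : 0 <= tau < PI).
  { destruct HN as [HN1 HN2]; apply IZR_le in HN1, HN2.
    rewrite !plus_IZR, minus_IZR, !mult_IZR in HN2.
    rewrite minus_IZR, mult_IZR in HN1.
    rewrite plus_IZR in Hth.
    apply (Rmult_le_compat_r theta) in HN1, HN2; [|lra|lra].
    unfold tau; rewrite <- Hkt. lra. }
  assert (Hpos : 0 < sin tau \/ sin tau = 0 /\ 0 < cos tau).
  { destruct Htau as [[H0|H0] HP].
    - left; apply sin_gt_0; assumption.
    - right; rewrite <- H0, sin_0, cos_0; lra. }
  unfold axis_lo.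
  destruct (Z.even N) eqn:Ev.
  - apply Z.even_spec in Ev; destruct Ev as [M HM].
    replace (th - IZR i * theta) with (tau + 2 * IZR M * PI) in Hx, Hy
      by (unfold tau; rewrite HM, mult_IZR; ring).
    destruct (cos_sin_shift tau M) as [Ec Es]; rewrite Ec in Hx; rewrite Es in Hy.
    destruct Hpos as [Hp|[Hp Hp']]; [left; nra|right; rewrite Hp in Hy; split; nra].
  - assert (Od : Z.odd N = true) by (rewrite <- Z.negb_even, Ev; reflexivity).
    apply Z.odd_spec in Od; destruct Od as [M HM].
    replace (th - IZR i * theta) with (tau + PI + 2 * IZR M * PI) in Hx, Hy
      by (unfold tau; rewrite HM, plus_IZR, mult_IZR; ring).
    destruct (cos_sin_shift (tau + PI) M) as [Ec Es]; rewrite Ec, neg_cos in Hx.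
    rewrite Es, neg_sin in Hy.
    destruct Hpos as [Hp|[Hp Hp']]; [left; nra|right; rewrite Hp in Hy; split; nra].
Qed.

Lemma axis_frame i : let phi := IZR i * theta in
  frame (2 * k) (axis_x phi) (axis_y phi) (axis_lo phi).
Proof.
  intros phi; split.
  - apply axis_dist.
  - unfold axis_lo; intros p H; lra.
  - unfold axis_lo; intros p q r H H'; lra.
  - intros p q; unfold axis_lo.
    destruct (Rtotal_order (axis_y phi p) (axis_y phi q)) as [H|[H|H]]; [tauto| |tauto].
    destruct (Rtotal_order (axis_x phi p) (axis_x phi q)) as [H'|[H'|H']]; [tauto| |].
    + left; apply NNPP; intros Hne; pose proof (dist_pos p q Hne).
      pose proof (axis_dist phi p q) as Hd; rewrite H, H' in Hd; nra.
    + right; right; right; lra.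
  - unfold axis_lo; intros p q H; lra.
  - intros j p q x Hq Hx Hlo; apply cone_zcone in Hq, Hx.
    destruct (zcone_side i (Z.of_nat j)) as [[|] Hs]; fold phi in Hs.
    + exfalso; specialize (Hs _ _ Hq); unfold axis_lo in *; lra.
    + apply Hs; exact Hx.
  - intros j p q x Hq Hx Hlo; apply cone_zcone in Hq, Hx.
    destruct (zcone_side i (Z.of_nat j)) as [[|] Hs]; fold phi in Hs.
    + apply Hs; exact Hx.
    + exfalso; specialize (Hs _ _ Hq); unfold axis_lo in *; lra.
Qed.

End Cones.

(** * Progress towards the target *)

(** The lower bound yields [rate <= 0.36], as required of [c / t]; the upper bound keeps [rate]
    positive from [k = 42] on. *)
Lemma sin_PI8_bounds : 0.32 <= sin (PI / 8) <= 0.3828.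
Proof.
  pose proof PI_RGT_0; pose proof PI_4.
  assert (Hnn : 0 <= sin (PI / 8)) by (apply sin_ge_0; lra).
  assert (Hd : cos (PI / 4) = 1 - 2 * sin (PI / 8) * sin (PI / 8)).
  { rewrite <- cos_2a_sin; f_equal; field. }
  rewrite cos_PI4 in Hd.
  assert (Hs : 1.414 <= sqrt 2 <= 1.415).
  { pose proof (sqrt_pos 2); pose proof (pow2_sqrt 2 ltac:(lra)); split; nra. }
  assert (Hi : 1 / sqrt 2 = sqrt 2 / 2).
  { pose proof (pow2_sqrt 2 ltac:(lra)); apply Rmult_eq_reg_l with (sqrt 2); [|lra].
    replace (sqrt 2 * (1 / sqrt 2)) with 1 by (field; lra). lra. }
  rewrite Hi in Hd; split; apply le_of_sqr_le; nra.
Qed.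

(** Triangle inequality through the point at distance [b] on the side of length [a]: the rest is
    [a - b], and the chord is at most [g * b]. *)
Lemma progress a b g D x :
  0 <= b <= a -> 0 <= g <= 2 -> 1 - g ^ 2 / 2 <= x ->
  D ^ 2 = a ^ 2 + b ^ 2 - 2 * (a * b) * x -> D <= a - (1 - g) * b.
Proof.
  intros Hb Hg Hx HD.
  assert (Hab : 0 <= a * b) by (apply Rmult_le_pos; lra).
  assert (Hm : (a * b) * (1 - g ^ 2 / 2) <= (a * b) * x)
    by (apply Rmult_le_compat_l; assumption).
  assert (Hn : 0 <= (a - b) * b * (g * (2 - g))).
  { apply Rmult_le_pos; apply Rmult_le_pos; lra. }
  apply le_of_sqr_le; nra.
Qed.

Lemma cos_within x psi : - psi <= x <= psi -> psi <= PI -> cos psi <= cos x.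
Proof.
  intros Hx Hpsi; destruct (Rle_or_lt 0 x) as [H|H].
  - apply cos_decr_1; lra.
  - rewrite <- (cos_neg x); apply cos_decr_1; lra.
Qed.

(** * The spanner property for a fixed [k] *)

Section Spanner.

Context (k : nat) (P : list pt) (Ysel YYsel : pt -> nat -> option pt) (t : R).
Context (Hk : (42 <= k)%nat).
Context (HY : yao_selection P (2 * k) Ysel).
Context (HYY : yaoyao_selection P (2 * k) Ysel YYsel).
Let theta := PI / INR k.
(** The angle between first edge and target is at most [PI / 4 + 1.25 * theta]; twice the sine of
    its half is at most [2 * sin (PI / 8) + 1.25 * theta]. *)
Let rate := 1 - 2 * sin (PI / 8) - 1.25 * theta.
Context (Ht : 0 < t).
Context (Hbudget : 1 + 1.6 * t * theta <= t * rate * (1 - theta)).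

Let E := yaoyao_edge P (2 * k) Ysel YYsel.

Lemma k_pos : (0 < k)%nat.
Proof. lia. Qed.

Lemma theta_bounds : 0 < theta <= 0.0755.
Proof.
  split; [apply theta_pos; exact k_pos|].
  assert (H42 : 42 <= INR k) by (apply le_INR in Hk; simpl in Hk; lra).
  pose proof PI_le; unfold theta.
  apply Rmult_le_reg_r with (INR k); [lra|].
  replace (PI / INR k * INR k) with PI by (field; lra). nra.
Qed.

(** The angle is half the largest span [PI / 2 + theta / 2], and [0.63 = 0.7 * 0.9] splits its
    cosine by the addition formula. *)
Lemma flat_direction r x : 0 < r ->
  - (PI / 4 + theta / 4) <= x <= PI / 4 + theta / 4 -> 0.63 * r <= r * cos x.
Proof.
  intros Hr Hx; pose proof theta_bounds; pose proof PI_RGT_0.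
  assert (Hc : cos (PI / 4 + theta / 4) <= cos x).
  { apply cos_within; [exact Hx|]. pose proof PI2_3_2; lra. }
  assert (0.63 <= cos (PI / 4 + theta / 4)).
  { rewrite cos_plus, sin_PI4, cos_PI4.
    assert (0.7 <= 1 / sqrt 2).
    { pose proof (sqrt_lt_R0 2 ltac:(lra)); pose proof (pow2_sqrt 2 ltac:(lra)).
      apply Rmult_le_reg_r with (sqrt 2); [lra|].
      replace (1 / sqrt 2 * sqrt 2) with 1 by (field; lra). nra. }
    pose proof (cos_lower (theta / 4)).
    pose proof (sin_le_id (theta / 4) ltac:(lra)).
    assert (0.9 <= cos (theta / 4) - sin (theta / 4)) by nra.
    replace (1 / sqrt 2 * cos (theta / 4) - 1 / sqrt 2 * sin (theta / 4))
      with (1 / sqrt 2 * (cos (theta / 4) - sin (theta / 4))) by ring.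
    nra. }
  nra.
Qed.

(* u sees nothing closer than v in the cones i0, ..., i1 - 1, which together span at
   least a right angle; of the two boundary rays the one nearer to v supplies the frame. *)
Lemma sector_edge (u v : pt) (i0 i1 : Z) (j : nat) :
  In u P -> In v P ->
  (forall p q, In p P -> In q P -> dist p q <= dist u v ->
     short P (2 * k) Ysel YYsel (t * rate) p q) ->
  IZR (i1 - i0) * theta <= PI / 2 + theta / 2 -> PI / 2 <= IZR (i1 - i0) * theta ->
  sector u (IZR i0 * theta) (IZR i1 * theta) v ->
  (forall z, In z P -> sector u (IZR i0 * theta) (IZR i1 * theta) z ->
     dist u v <= dist u z) ->
  (j < 2 * k)%nat -> Ysel u j = Some v ->
  linked E u v (t * rate * dist u v).
Proof.
  intros Hu Hv Hshort Hw1 Hw2 [r [th [Hr [Hth [H1 H2]]]]] Hmin Hj Hsel.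
  pose proof PI_RGT_0 as HPI; pose proof theta_bounds as Hth0; pose proof PI2_3_2.
  pose proof (polar_dist _ _ _ _ Hr H1 H2) as Hd.
  rewrite minus_IZR in Hw1, Hw2.
  specialize (Hshort u v Hu Hv (Rle_refl _)).
  destruct (Rle_or_lt (IZR i1 * theta - th) (PI / 4 + theta / 4)) as [Htop|Hbot].
  - destruct (axis_polar (IZR i1 * theta) u v r th H1 H2) as [Hx Hy].
    assert (Hneg : axis_y (IZR i1 * theta) v < axis_y (IZR i1 * theta) u).
    { assert (sin (th - IZR i1 * theta) < 0) by (apply sin_lt_0_var; lra). nra. }
    apply (Hshort _ _ _ j (axis_frame k k_pos i1)); try assumption; fold theta.
    + left; exact Hneg.
    + rewrite Hd, Hx; apply flat_direction; [exact Hr|lra].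
    (* The whole quadrant below this ray fits into the sector, so [z] competes with [v]. *)
    + intros z Hz Hlo Hxz Hlt _.
      destruct (polar_right (axis_x (IZR i1 * theta) z - axis_x (IZR i1 * theta) u)
                  (axis_y (IZR i1 * theta) z - axis_y (IZR i1 * theta) u))
        as [s [ph [Hs [Hph [E1 [E2 [_ Hph0]]]]]]]; [lra|].
      assert (ph < 0) by (apply Hph0; unfold axis_lo in Hlo; lra).
      destruct (axis_inverse _ _ _ _ _ E1 E2) as [F1 F2].
      assert (dist u v <= dist u z); [|lra].
      apply Hmin; [exact Hz|]; exists s, (IZR i1 * theta + ph).
      split; [exact Hs|split; [lra|tauto]].
  (* The lower ray must become the horizontal one with the sector below it: a half turn followed by
     a mirror reflects in the line of [i0] and keeps the tie rule correct. *)
  - set (i' := (i0 + Z.of_nat k)%Z).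
    pose proof (k_theta k k_pos) as Hkt; fold theta in Hkt.
    assert (Hi' : IZR i' * theta = IZR i0 * theta + PI).
    { unfold i'; rewrite plus_IZR, <- Hkt; ring. }
    assert (Hopp : forall p q,
      axis_x (IZR i0 * theta) q - axis_x (IZR i0 * theta) p
        = - axis_x (IZR i' * theta) q - - axis_x (IZR i' * theta) p /\
      axis_y (IZR i0 * theta) q - axis_y (IZR i0 * theta) p
        = axis_y (IZR i' * theta) p - axis_y (IZR i' * theta) q).
    { intros p q; unfold axis_x, axis_y; rewrite Hi', neg_cos, neg_sin; split; ring. }
    destruct (axis_polar (IZR i0 * theta) u v r th H1 H2) as [Hx Hy].
    destruct (Hopp u v) as [Ox Oy]; rewrite Ox in Hx; rewrite Oy in Hy.
    assert (Hflat : 0.63 * r <= r * cos (th - IZR i0 * theta))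
      by (apply flat_direction; [exact Hr|lra]).
    apply (Hshort _ _ _ j (frame_mirror _ _ _ _ (axis_frame k k_pos i')));
      try assumption; fold theta.
    + assert (0 <= sin (th - IZR i0 * theta)) by (apply sin_ge_0; lra).
      assert (0 <= r * sin (th - IZR i0 * theta)) by (apply Rmult_le_pos; lra).
      (* [v] may lie on the ray of [i0] itself; then the heights agree and the tie rule decides. *)
      unfold axis_lo; destruct (Req_dec (axis_y (IZR i' * theta) v)
                                  (axis_y (IZR i' * theta) u)) as [Heq|Hne]; [right|left]; lra.
    + rewrite Hd, Hx; exact Hflat.
    + intros z Hz Hlo Hxz Hlt _.
      destruct (Hopp u z) as [Ox' Oy'].
      destruct (polar_right (axis_x (IZR i0 * theta) z - axis_x (IZR i0 * theta) u)
                  (axis_y (IZR i0 * theta) z - axis_y (IZR i0 * theta) u))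
        as [s [ph [Hs [Hph [E1 [E2 [Hph0 _]]]]]]]; [lra|].
      assert (0 <= ph) by (apply Hph0; unfold axis_lo in Hlo; lra).
      destruct (axis_inverse _ _ _ _ _ E1 E2) as [F1 F2].
      assert (dist u v <= dist u z); [|lra].
      apply Hmin; [exact Hz|]; exists s, (IZR i0 * theta + ph).
      split; [exact Hs|split; [lra|tauto]].
Qed.

Lemma yaoyao_spanner : is_spanner P E t.
Proof.
  unfold is_spanner; refine (distance_induction P _ _).
  intros u z Hu Hz IH.
  destruct (classic (z = u)) as [->|Hne].
  { rewrite dist_refl, Rmult_0_r; apply linked_refl. }
  pose proof PI_RGT_0 as HPI; pose proof theta_bounds as Hth0.
  pose proof sin_PI8_bounds as Hs8; pose proof PI2_3_2.
  pose proof (k_theta k k_pos) as Hkt; fold theta in Hkt.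
  destruct (zcone_exists k k_pos u z Hne) as [n Hn].
  (* The sector consists of [L = ceil (k / 2)] cones, [L / 2] of them before the cone [n] of [z]. *)
  set (L := ((Z.of_nat k + 1) / 2)%Z).
  set (i0 := (n - L / 2)%Z).
  set (i1 := (i0 + L)%Z).
  assert (HL : (Z.of_nat k <= 2 * L <= Z.of_nat k + 1)%Z).
  { unfold L; pose proof (Z.div_mod (Z.of_nat k + 1) 2 ltac:(lia)).
    pose proof (Z.mod_pos_bound (Z.of_nat k + 1) 2 ltac:(lia)); lia. }
  assert (HL2 : (2 * (L / 2) <= L <= 2 * (L / 2) + 1)%Z).
  { pose proof (Z.div_mod L 2 ltac:(lia)).
    pose proof (Z.mod_pos_bound L 2 ltac:(lia)); lia. }
  assert (Hspan : PI / 2 <= IZR (i1 - i0) * theta <= PI / 2 + theta / 2).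
  { replace (i1 - i0)%Z with L by (unfold i1; lia).
    destruct HL as [A B]; apply IZR_le in A, B.
    rewrite plus_IZR, mult_IZR in B; rewrite mult_IZR in A.
    apply (Rmult_le_compat_r theta) in A, B; lra. }
  assert (Hnear : forall p q, In p P -> In q P -> dist p q < dist u z ->
            linked E p q (t * dist p q)) by exact IH.
  assert (Hrate : 0 < rate <= 0.36).
  { unfold rate; lra. }
  assert (Hshort : forall p q, In p P -> In q P -> dist p q <= dist u z ->
            short P (2 * k) Ysel YYsel (t * rate) p q).
  { apply (short_edges P (2 * k) Ysel YYsel theta t (t * rate)); try assumption.
    - apply cone_cover; exact k_pos.
    - apply cone_opposite; exact k_pos.
    - apply cone_narrow; exact k_pos.
    - split; [apply Rmult_le_pos|]; nra. }
  assert (HzW : sector u (IZR i0 * theta) (IZR i1 * theta) z).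
  { apply (zcone_sector k k_pos i0 i1 n); [unfold i1, i0; lia|exact Hn]. }
  destruct (exists_nearest P u (sector u (IZR i0 * theta) (IZR i1 * theta)))
    as [v0 [Hv0 [Hv0W Hmin0]]]; [exists z; tauto|].
  destruct (sector_zcone k k_pos i0 i1 u v0 Hv0W) as [nv [Hnv Hcv0]].
  apply (zcone_cone_index k k_pos) in Hcv0.
  (* Because of ties, [v0] need not be a Yao choice; the Yao choice [v] in its cone is equally
     near. *)
  destruct (yao_nearest P (2 * k) Ysel HY u (cone_index k nv) v0 Hu
              (cone_index_lt k k_pos nv) Hv0 Hcv0) as [v [Hsel [Hv [Hcv Hdv]]]].
  apply (zcone_cone_index k k_pos) in Hcv.
  pose proof (zcone_sector k k_pos i0 i1 nv u v Hnv Hcv) as HvW; fold theta in HvW.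
  assert (Hmin : forall w, In w P -> sector u (IZR i0 * theta) (IZR i1 * theta) w ->
            dist u v <= dist u w).
  { intros w Hw HwW; specialize (Hmin0 w Hw HwW); lra. }
  pose proof (Hmin z Hz HzW) as Hvz.
  assert (Huv : linked E u v (t * rate * dist u v)).
  { apply (sector_edge u v i0 i1 (cone_index k nv)); try assumption; try lra.
    - intros p q Hp Hq Hpq; apply Hshort; [assumption..|lra].
    - apply cone_index_lt; exact k_pos. }
  assert (Hprog : dist v z <= dist u z - rate * dist u v).
  { destruct Hn as [a [tz [Ha [Htz [Z1 Z2]]]]].
    destruct HvW as [b [tv [Hb [Htv [V1 V2]]]]].
    fold theta in Htz.
    pose proof (polar_dist _ _ _ _ Ha Z1 Z2) as Da.
    pose proof (polar_dist _ _ _ _ Hb V1 V2) as Db.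
    rewrite Da, Db in *.
    replace rate with (1 - (2 * sin (PI / 8) + 1.25 * theta)) by (unfold rate; ring).
    apply progress with (x := cos (tz - tv)); [lra|lra| |].
    - set (psi := PI / 4 + 1.25 * theta).
      apply Rle_trans with (cos psi).
      + replace psi with (2 * (PI / 8 + 0.625 * theta)) by (unfold psi; lra).
        rewrite cos_2a_sin.
        assert (Hsum : 0 <= sin (PI / 8 + 0.625 * theta) <= sin (PI / 8) + 0.625 * theta).
        { split; [apply sin_ge_0; lra|].
          rewrite sin_plus.
          pose proof (COS_bound (0.625 * theta)); pose proof (COS_bound (PI / 8)).
          pose proof (sin_le_id (0.625 * theta) ltac:(lra)).
          assert (0 <= sin (0.625 * theta)) by (apply sin_ge_0; lra).
          nra. }
        nra.
      + apply cos_within; [|unfold psi; lra].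
        (* Cone [n] together with the cones on either side of it amounts to at most [(k + 5) / 4]
           cones, that is [PI / 4 + 1.25 * theta]. *)
        assert (B1 : (2 * (2 * (n + 1 - i0)) <= Z.of_nat k + 1 + 4)%Z) by (unfold i0; lia).
        assert (B2 : (2 * (2 * (i1 - n)) <= Z.of_nat k + 1 + 4)%Z) by (unfold i1, i0; lia).
        apply IZR_le in B1, B2.
        rewrite !plus_IZR, !mult_IZR, minus_IZR, plus_IZR in B1.
        rewrite !plus_IZR, !mult_IZR, minus_IZR in B2.
        rewrite plus_IZR in Htz.
        apply (Rmult_le_compat_r theta) in B1, B2; [|lra|lra].
        unfold psi; lra.
    - pose proof (sin2_cos2 tz) as E1; pose proof (sin2_cos2 tv) as E2.
      unfold Rsqr in E1, E2.
      rewrite dist_sqr, Z1, Z2, V1, V2, cos_minus.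
      replace (a ^ 2) with (a ^ 2 * (sin tz * sin tz + cos tz * cos tz)) by (rewrite E1; ring).
      replace (b ^ 2) with (b ^ 2 * (sin tv * sin tv + cos tv * cos tv)) by (rewrite E2; ring).
      ring. }
  assert (Hpos : 0 < dist u v).
  { apply dist_pos; intros Heq; apply (sector_neq _ _ _ _ HvW); congruence. }
  apply linked_le with (t * rate * dist u v + t * dist v z).
  - apply linked_trans with v; [exact Huv|].
    apply Hnear; [assumption..|nra].
  - assert (t * dist v z <= t * (dist u z - rate * dist u v))
      by (apply Rmult_le_compat_l; lra).
    lra.
Qed.

End Spanner.

Theorem theorem2 :
  exists t : nat -> R,
    (exists C : R, exists K0 : nat, forall k : nat, (K0 <= k)%nat ->
        Rabs (t k - t_limit) <= C / INR k) /\
    (forall k : nat, (42 <= k)%nat ->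
      forall (P : list pt) (Ysel YYsel : pt -> nat -> option pt),
        yao_selection P (2 * k) Ysel ->
        yaoyao_selection P (2 * k) Ysel YYsel ->
        is_spanner P (yaoyao_edge P (2 * k) Ysel YYsel) (t k)).
Proof.
  (* From [k = 1000] on the limit itself is a valid ratio, so the error term is zero there; 1000 is
     a valid ratio for all smaller [k >= 42]. *)
  exists (fun k => if Nat.leb 1000 k then t_limit else 1000).
  split.
  - exists 0, 1000%nat; intros k Hk.
    rewrite (proj2 (Nat.leb_le _ _) Hk).
    rewrite Rminus_diag, Rabs_R0; unfold Rdiv; lra.
  - intros k Hk P Ysel YYsel HY HYY.
    pose proof (theta_bounds k Hk) as Hth.
    pose proof sin_PI8_bounds as Hs8.
    destruct (Nat.leb_spec 1000 k) as [Hbig|Hsmall].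
    + assert (H1000 : 1000 <= INR k) by (apply le_INR in Hbig; simpl in Hbig; lra).
      assert (Hth' : PI / INR k <= 0.004).
      { apply Rmult_le_reg_r with (INR k); [lra|].
        replace (PI / INR k * INR k) with PI by (field; lra).
        pose proof PI_4; nra. }
      assert (Hsq : 1.414 <= sqrt 2 <= 1.415).
      { pose proof (sqrt_pos 2); pose proof (pow2_sqrt 2 ltac:(lra)); split; nra. }
      assert (Hlim : t_limit * (1 - 2 * sin (PI / 8)) = sqrt 2).
      { unfold t_limit; field; lra. }
      assert (Ht : 0 < t_limit <= 6.1).
      { split; nra. }
      apply yaoyao_spanner; try assumption; [lra|].
      (* The main term of the budget is [sqrt 2] against the required 1; this slack absorbs all
         terms in [theta]. *)
      replace (t_limit * (1 - 2 * sin (PI / 8) - 1.25 * (PI / INR k)))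
        with (sqrt 2 - 1.25 * (t_limit * (PI / INR k))) by (rewrite <- Hlim; ring).
      assert (t_limit * (PI / INR k) <= 6.1 * 0.004)
        by (apply Rmult_le_compat; lra).
      assert (1.3 * (1 - 0.004)
              <= (sqrt 2 - 1.25 * (t_limit * (PI / INR k))) * (1 - PI / INR k))
        by (apply Rmult_le_compat; lra).
      lra.
    + apply yaoyao_spanner; try assumption; [lra|].
      (* At [theta = 0.0755] the budget divided by [t] reads [1 / t + 0.1208 <= 0.1294...], which
         [t = 1000] satisfies. *)
      assert ((1 - 2 * 0.3828 - 1.25 * 0.0755) * (1 - 0.0755)
              <= (1 - 2 * sin (PI / 8) - 1.25 * (PI / INR k)) * (1 - PI / INR k))
        by (apply Rmult_le_compat; lra).
      lra.
Qed.
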